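(* There is an absolute constant $c>0$ and a deterministic LOCAL algorithm with the following property. Let $H=(V,E)$ be a hypergraph of maximum degree at most $\Delta$ and rank at most $r$, given with a good coloring and an edge-weighting $a$. Then the algorithm runs in $\tilde O(\log^2\Delta+r\log\Delta)$ rounds and outputs a matching $M$ of $H$ with $$a(M)\ge c\,\frac{a(E)}{r\Delta}.$$
   Context: **Hypergraph notation.** For a hypergraph $H=(V,E)$: - $E$ may be a multiset. - $N(v)$ is the set of edges containing $v$, and $\deg(v)=|N(v)|$. - A matching is a set of pairwise disjoint edges. **Weights.** An edge-weighting is $a:E\to[0,\infty)$, and $a(L)=\sum_{e\in L}a(e)$. **LOCAL model.** The model is run on the incidence graph $\mathrm{Inc}(H)$, the bipartite graph with one node per vertex and per edge of $H$, where $v$ and $e$ are adjacent iff $v\in e$. - In synchronous rounds, nodes do unbounded computation and exchange unbounded messages with neighbours. - Nodes have unique IDs. - Upper bounds $n,\Delta,r\ (r\ge2)$ are globally known. **Good coloring.** A good coloring of $H$ is a proper vertex coloring of $\mathrm{Inc}(H)^2$ (nodes adjacent iff at distance $\le 2$ in $\mathrm{Inc}(H)$) with $\mathrm{poly}(r,\Delta)$ colors. **Notation.** $\tilde O(x)=x\cdot\mathrm{polylog}(x)$. *)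

(* Defs.v *)
From Stdlib Require Import Reals.
From mathcomp Require Import all_boot.

Set Implicit Arguments.
Unset Strict Implicit.
Unset Printing Implicit Defensive.

(* A hypergraph H = (V, E): V and E are finite types, E indexes the edges
   (so E may be a multiset), inc e is the vertex set of edge e. *)

Definition inc_adj (V E : finType) (inc : E -> {set V}) (x y : (V + E)%type) : bool :=
  match x, y with
  | inl v, inr e => v \in inc e
  | inr e, inl v => v \in inc e
  | _, _ => false
  end.

Definition dist_le2 (V E : finType) (inc : E -> {set V}) (x y : (V + E)%type) : bool :=
  inc_adj inc x y || [exists z, inc_adj inc x z && inc_adj inc z y].

Definition good_coloring (V E : finType) (inc : E -> {set V})
    (col : (V + E)%type -> nat) (K : nat) : Prop :=
  (forall x, col x < K) /\
  (forall x y, x != y -> dist_le2 inc x y -> col x != col y).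

Definition deg (V E : finType) (inc : E -> {set V}) (v : V) : nat :=
  #|[set e | v \in inc e]|.

Definition is_matching (V E : finType) (inc : E -> {set V}) (M : {set E}) : Prop :=
  forall e f, e \in M -> f \in M -> e != f -> [disjoint inc e & inc f].

Definition wsum (E : finType) (a : E -> R) (L : {set E}) : R :=
  foldr (fun e acc => Rplus (a e) acc) R0 (enum L).

(* A view: local input label of a node and the views of its neighbours. *)
Inductive view (L : Type) : Type :=
  VNode : L -> list (view L) -> view L.

Definition label := (nat * nat * option R)%type.

Definition node_label (V E : finType) (a : E -> R) (id col : (V + E)%type -> nat)
    (x : (V + E)%type) : label :=
  (id x, col x, match x with inl _ => None | inr e => Some (a e) end).

Definition nbrs (V E : finType) (inc : E -> {set V}) (id : (V + E)%type -> nat)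
    (x : (V + E)%type) : seq (V + E)%type :=
  sort (fun y z => id y <= id z) [seq y <- enum [set: (V + E)%type] | inc_adj inc x y].

(* The information a node x has gathered after k synchronous rounds of a
   full-information LOCAL algorithm on Inc(H). Any deterministic k-round LOCAL
   algorithm's output at x is a function of this view. *)
Fixpoint view_at (V E : finType) (inc : E -> {set V}) (a : E -> R)
    (id col : (V + E)%type -> nat) (k : nat) (x : (V + E)%type) : view label :=
  match k with
  | 0 => VNode (node_label a id col x) [::]
  | k'.+1 => VNode (node_label a id col x) (map (view_at inc a id col k') (nbrs inc id x))
  end.

(* Round-complexity bound  O~(log^2 Delta + r log Delta) with explicit
   constant C and polylog exponent k (logs are ceiling base-2 logs). *)
Definition log_param (Delta r : nat) : nat :=
  (up_log 2 Delta) ^ 2 + r * up_log 2 Delta.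

Definition rounds_bound (C k Delta r : nat) : nat :=
  C * (log_param Delta r).+1 * (up_log 2 (log_param Delta r).+2) ^ k.

(* Main.v *)
Require Import Defs.
From Stdlib Require Import Reals FunctionalExtensionality IndefiniteDescription.
From mathcomp Require Import all_boot all_order all_algebra finfield Rstruct zify ring lra.

(* Let f ~ e mean that distinct edges e and f intersect.  Any x : E -> {0, 1} gives the
   matching of the edges e with x_e = 1 and no f ~ e with x_f = 1, whose value is at least
   Phi_1(x), where
     Phi_lam(x) = sum_e a_e x_e - lam * sum_e sum_(f ~ e) a_e x_e x_f.
   The constant x = 2^-n with 2^n about 4 r Delta has Phi_2(x) >= a(E) 2^-n / 2, and it is
   rounded in n steps, each replacing every x_e by 0 or 2 x_e.

   A rounding step goes sequentially through the classes of a coloring chi of E, every edge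
   making the choice that does not decrease the conditional expectation of Phi_lam without the
   monochromatic pairs.  The quadratic cost of the monochromatic pairs, if at most a fraction
   O(1/n) of the total, is paid for by lowering lam by 1/n; over the n steps lam goes from 2
   to 1 and the potential never decreases.

   Such a chi needs only O(n) colors: a first coloring with B = O(sqrt n) colors keeps a
   fraction 3/B of the total weight monochromatic, and refining it in the same way squares this
   fraction.  Each of the two is found by going sequentially, again by conditional expectations,
   through a coloring with B^2 polylog(n) colors and defect 2/B, which comes from the input
   coloring by two Reed-Solomon recolourings.  This gives n * O(n log^2 n) rounds. *)

Set Implicit Arguments.
Unset Strict Implicit.
Unset Printing Implicit Defensive.

Import Order.TTheory GRing.Theory Num.Theory.

(** * Sequential conditional expectations *)

Section ConditionalExpectations.
Local Open Scope ring_scope.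

Variable R : realFieldType.

Lemma dsum_sym (E : finType) (adj : rel E) (F : E -> E -> R) :
  symmetric adj ->
  \sum_e \sum_(f | adj e f) F e f = \sum_e \sum_(f | adj e f) F f e.
Proof.
move=> adjC; rewrite (exchange_big_dep predT) //=.
by apply: eq_bigr => e _; apply: eq_bigl => f; rewrite adjC.
Qed.

Lemma arg_min_le_mean (m : nat) (F : 'I_m.+1 -> R) (v : R) :
  \sum_i F i <= m.+1%:R * v -> F [arg min_(i < ord0) F i]%O <= v.
Proof.
move=> Fv; case: arg_minP => // i _ Fi.
rewrite -(ler_pM2l (ltr0Sn _ m)) (le_trans _ Fv) // -[m.+1 in leLHS]card_ord.
rewrite mulr_natl -sumr_const; apply: ler_sum => k _; exact: Fi.
Qed.

Variables (E : finType) (adj : rel E) (S Y : Type) (m : nat).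
Variables (psi : S -> nat) (U : S -> Y -> R) (P : S -> S -> Y -> Y -> R).
Variable cand : Y -> 'I_m.+1 -> Y.

(** [s e] is the fixed data of a node and [y e] its changing state. Pairs inside one [psi]-class are
    left out, so that the nodes of a class can choose simultaneously. *)
Definition local_cost (s : E -> S) (y : E -> Y) (e : E) (z : Y) : R :=
  U (s e) z + \sum_(f | adj e f) (psi (s f) != psi (s e))%:R * P (s e) (s f) z (y f).

Definition pass_step (s : E -> S) (j : nat) (y : E -> Y) (e : E) : Y :=
  if psi (s e) == j
  then cand (y e) [arg min_(i < ord0) local_cost s y e (cand (y e) i)]%O else y e.

Fixpoint pass (s : E -> S) (y : E -> Y) (j : nat) : E -> Y :=
  if j is j'.+1 then pass_step s j' (pass s y j') else y.

Definition pass_cost (s : E -> S) (y : E -> Y) : R :=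
  \sum_e U (s e) (y e) +
  2^-1 * \sum_e \sum_(f | adj e f)
           (psi (s f) != psi (s e))%:R * P (s e) (s f) (y e) (y f).

Hypothesis adjC : symmetric adj.
Hypothesis P_sym : forall s t y z, P s t y z = P t s z y.
Hypothesis U_mean : forall s y, \sum_i U s (cand y i) = m.+1%:R * U s y.
Hypothesis P_mean :
  forall s t y z, \sum_i P s t (cand y i) z = m.+1%:R * P s t y z.

(** A pair counted in the cost has at most one end in class [j]. By symmetry the two orders of such
    a pair cancel the factor 1/2, and what is left involves only nodes outside the class. *)
Lemma pass_cost_split (s : E -> S) (y : E -> Y) (j : nat) :
  pass_cost s y =
  \sum_e (psi (s e) == j)%:R * local_cost s y e (y e) +
  (\sum_e (psi (s e) != j)%:R * U (s e) (y e) +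
   2^-1 * \sum_e \sum_(f | adj e f) (psi (s f) != psi (s e))%:R *
      (psi (s e) != j)%:R * (psi (s f) != j)%:R * P (s e) (s f) (y e) (y f)).
Proof.
pose G e f := (psi (s f) != psi (s e))%:R * P (s e) (s f) (y e) (y f).
have -> : \sum_e (psi (s e) == j)%:R * local_cost s y e (y e) =
  \sum_e (psi (s e) == j)%:R * U (s e) (y e) +
  \sum_e \sum_(f | adj e f) (psi (s e) == j)%:R * G e f.
  rewrite -big_split; apply: eq_bigr => e _; rewrite mulrDr; congr (_ + _).
  by rewrite mulr_sumr.
have e2 : \sum_e \sum_(f | adj e f) (psi (s e) == j)%:R * G e f =
   2^-1 * (\sum_e \sum_(f | adj e f)
     ((psi (s e) == j)%:R + (psi (s f) == j)%:R) * G e f).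
  have -> : \sum_e \sum_(f | adj e f)
     ((psi (s e) == j)%:R + (psi (s f) == j)%:R) * G e f =
     \sum_e \sum_(f | adj e f) (psi (s e) == j)%:R * G e f +
     \sum_e \sum_(f | adj e f) (psi (s f) == j)%:R * G e f.
    rewrite -big_split; apply: eq_bigr => e _.
    by rewrite -big_split; apply: eq_bigr => f _; rewrite mulrDl.
  rewrite [X in _ * (_ + X)]dsum_sym //.
  rewrite [X in _ * (_ + X)](_ : _ = \sum_e \sum_(f | adj e f)
     (psi (s e) == j)%:R * G e f); first by lra.
  apply: eq_bigr => e _; apply: eq_bigr => f _.
  by rewrite /G P_sym [psi (s e) == psi (s f)]eq_sym.
rewrite e2 addrACA -big_split -mulrDr -big_split /pass_cost; congr (_ + _ * _).
  by apply: eq_bigr => e _; rewrite /= -mulrDl; case: eqP => _ /=; rewrite ?addr0 ?add0r mul1r.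
apply: eq_bigr => e _; rewrite -big_split; apply: eq_bigr => f _ /=.
rewrite /G; case: (eqVneq (psi (s e)) j) => ej; case: (eqVneq (psi (s f)) j) => fj;
  rewrite /= ?ej ?fj ?eqxx /=; ring.
Qed.

(** Within class [j] the local costs do not depend on each other's choices. By [U_mean] and [P_mean]
    the local cost of the current state is the mean over its candidates, so the minimizing candidate
    does not exceed it. *)
Lemma pass_step_le (s : E -> S) (y : E -> Y) (j : nat) :
  pass_cost s (pass_step s j y) <= pass_cost s y.
Proof.
rewrite (pass_cost_split s y j) (pass_cost_split s (pass_step s j y) j).
apply: lerD.
  apply: ler_sum => e _; case: eqP => [ej|_]; last by rewrite !mul0r.
  rewrite !mul1r.
  have -> : local_cost s (pass_step s j y) e (pass_step s j y e)
    = local_cost s y e (cand (y e) [arg min_(i < ord0) local_cost s y e (cand (y e) i)]%O).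
    rewrite {2}/pass_step ej eqxx /local_cost; congr (_ + _).
    apply: eq_bigr => f _; rewrite /pass_step.
    by case: (eqVneq (psi (s f)) j) => // ->; rewrite ej eqxx !mul0r.
  apply: (@arg_min_le_mean _ (fun i => local_cost s y e (cand (y e) i))).
  rewrite le_eqVlt; apply/orP; left; apply/eqP.
  rewrite /local_cost big_split U_mean mulrDr; congr (_ + _).
  rewrite exchange_big mulr_sumr; apply: eq_bigr => f _.
  by rewrite -mulr_sumr P_mean; ring.
have stepN e : psi (s e) != j -> pass_step s j y e = y e.
  by rewrite /pass_step => /negPf->.
rewrite lerD //.
  apply: ler_sum => e _; case: eqP => [|/eqP ej]; first by rewrite !mul0r.
  by rewrite stepN.
rewrite ler_wpM2l ?invr_ge0 ?ler0n //; apply: ler_sum => e _; apply: ler_sum => f _.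
case: (eqVneq (psi (s e)) j) => [|ej]; first by rewrite mulr0 !mul0r.
case: (eqVneq (psi (s f)) j) => [|fj]; first by rewrite mulr0 !mul0r.
by rewrite !stepN.
Qed.

Lemma pass_le (s : E -> S) (y : E -> Y) (q : nat) :
  pass_cost s (pass s y q) <= pass_cost s y.
Proof. by elim: q => //= q; apply: le_trans; apply: pass_step_le. Qed.

(** A node changes state only in the step of its own class, and until then it still holds its
    initial state. *)
Lemma pass_cand (s : E -> S) (y : E -> Y) (q : nat) (e : E) :
  (psi (s e) < q)%N -> exists i, pass s y q e = cand (y e) i.
Proof.
have undone k : (k <= psi (s e))%N -> pass s y k e = y e.
  elim: k => //= k IH le_k; rewrite /pass_step ifN ?IH ?(ltnW le_k) //.
  by rewrite gtn_eqF.
elim: q => //= q IH; rewrite ltnS leq_eqVlt /pass_step.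
case: eqP => [eq_q _|_ /= /IH //]; rewrite undone ?eq_q //.
by eexists.
Qed.

End ConditionalExpectations.

(** * Defective colorings *)

(** This is an error-correcting code: the color [c] has the codeword [i => h i c], and distinct
    codewords agree in few positions. *)
Definition good_hash (m k : nat) (h : 'I_m.+1 -> nat -> nat) : Prop :=
  (forall i c, h i c < m.+1) /\
  (forall c c', c < m.+1 ^ k -> c' < m.+1 ^ k -> c != c' ->
     #|[set i | h i c == h i c']| <= k).

Section Defective.
Local Open Scope ring_scope.

Variable R : realFieldType.

(* Reed-Solomon codes over GF(2^j): two polynomials of degree < k agree on fewer than k points. *)
Lemma hash_family (m j k : nat) :
  (0 < j)%N -> m.+1 = (2 ^ j)%N ->
  exists h : 'I_m.+1 -> nat -> nat, good_hash k h.
Proof.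
move=> j_gt0 mE; have [F _ cardF] := PrimePowerField (isT : prime 2) j_gt0.
have cardFm : m.+1 = #|F| by rewrite cardF.
pose pol c : {poly F} :=
  if insub c is Some i then rVpoly (enum_val (i : 'I_#|{: 'rV[F]_k}|)) else 0.
pose pt (i : 'I_m.+1) : F := enum_val (cast_ord cardFm i).
exists (fun i c => enum_rank (pol c).[pt i] : nat); split=> [i c|c c' lt_c lt_c' ne_c].
  by rewrite (leq_trans (ltn_ord _)) // cardFm.
have cardV : #|{: 'rV[F]_k}| = (m.+1 ^ k)%N by rewrite card_mx mul1n -cardFm.
have polE d (lt_d : (d < #|{: 'rV[F]_k}|)%N) : pol d = rVpoly (enum_val (Ordinal lt_d)).
  by rewrite /pol insubT.
have size_pol d : (size (pol d) <= k)%N.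
  by rewrite /pol; case: insubP => [i _ _|_]; rewrite ?size_poly ?size_poly0.
have pol_inj : pol c - pol c' != 0.
  rewrite subr_eq0; rewrite -cardV in lt_c lt_c'; rewrite (polE _ lt_c) (polE _ lt_c').
  apply: contra ne_c => /eqP /(can_inj rVpolyK) /enum_val_inj [->] //.
apply: (@leq_trans (size (pol c - pol c'))); last first.
  by rewrite (leq_trans (size_polyD _ _)) // size_polyN geq_max !size_pol.
apply: ltnW; rewrite cardE -(size_map pt); apply: max_poly_roots => //.
  apply/allP => x /mapP [i]; rewrite mem_enum inE => /eqP /ord_inj /enum_rank_inj hi ->.
  by rewrite /root hornerD hornerN hi subrr.
rewrite map_inj_uniq ?enum_uniq // => i i' /enum_val_inj /cast_ord_inj //.
Qed.

Variables (E : finType) (adj : rel E).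

Definition total_wt (w : E -> E -> R) : R := \sum_e \sum_(f | adj e f) w e f.

Definition mono (c : E -> nat) (w : E -> E -> R) : R :=
  \sum_e \sum_(f | adj e f) (c f == c e)%:R * w e f.

Lemma mono_ge0 (c : E -> nat) (w : E -> E -> R) :
  (forall e f, 0 <= w e f) -> 0 <= mono c w.
Proof.
by move=> w_ge0; apply: sumr_ge0 => e _; apply: sumr_ge0 => f _; rewrite mulr_ge0 ?ler0n.
Qed.

Variables (S : Type) (wt : S -> S -> R).
Hypothesis wt_ge0 : forall s t, 0 <= wt s t.

Definition clash (m : nat) (h : 'I_m.+1 -> nat -> nat) (phi : S -> nat) (s : E -> S)
    (e : E) (i : 'I_m.+1) : R :=
  \sum_(f | adj e f)
    ((phi (s f) != phi (s e)) && (h i (phi (s f)) == h i (phi (s e))))%:R * wt (s e) (s f).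

(* Each node picks its own evaluation point [i]; the new color encodes [i] and the hash
   value, so two nodes newly sharing a color clash at the point picked by either of them. *)
Definition recolor (m : nat) (h : 'I_m.+1 -> nat -> nat) (phi : S -> nat) (s : E -> S)
    (e : E) : nat :=
  let i := [arg min_(i < ord0) clash h phi s e i]%O in (h i (phi (s e)) * m.+1 + i)%N.

Lemma recolor_lt (m : nat) (h : 'I_m.+1 -> nat -> nat) (phi : S -> nat) (s : E -> S) (e : E) :
  (forall i c, (h i c < m.+1)%N) -> (recolor h phi s e < m.+1 * m.+1)%N.
Proof.
move=> h_lt; rewrite /recolor; set i := [arg min_(_ < _) _]%O.
by rewrite (leq_trans (_ : _ < (h i (phi (s e))).+1 * m.+1)%N) ?leq_mul2r ?h_lt ?orbT //
  mulSn addnC ltn_add2r.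
Qed.

(** Two different old colors collide at no more than [k] of the [m.+1] points, so on average over
    the points, and hence at the best one, a node clashes with at most the fraction [k / m.+1] of
    its incident weight. *)
Lemma recolor_mono (m k : nat) (h : 'I_m.+1 -> nat -> nat) (phi : S -> nat) (s : E -> S) :
  (forall e f, phi (s e) != phi (s f) ->
     (#|[set i | h i (phi (s e)) == h i (phi (s f))]| <= k)%N) ->
  mono (recolor h phi s) (fun e f => wt (s e) (s f)) <=
  mono (phi \o s) (fun e f => wt (s e) (s f)) +
  k%:R / m.+1%:R * total_wt (fun e f => wt (s e) (s f)).
Proof.
move=> h_clash.
pose best e := [arg min_(i < ord0) clash h phi s e i]%O.
have best_le e : clash h phi s e (best e) <=
    k%:R / m.+1%:R * \sum_(f | adj e f) wt (s e) (s f).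
  apply: arg_min_le_mean; rewrite mulrA mulrCA divff ?mulr1 ?pnatr_eq0 //.
  rewrite exchange_big /= mulr_sumr; apply: ler_sum => f _.
  rewrite -mulr_suml ler_wpM2r //.
  case: (eqVneq (phi (s f)) (phi (s e))) => [_|ne].
    by rewrite big1.
  rewrite -natr_sum ler_nat; apply: leq_trans (h_clash _ _ ne).
  rewrite -sum1_card [leqRHS]big_mkcond /=; apply: leq_sum => i _.
  by rewrite inE; case: (_ == _).
rewrite /mono /total_wt mulr_sumr -big_split; apply: ler_sum => e _ /=.
apply: le_trans (lerD (lexx _) (best_le e)); rewrite /clash -big_split.
apply: ler_sum => f _; rewrite /= -mulrDl ler_wpM2r // -natrD ler_nat.
case: (eqVneq (recolor h phi s f) (recolor h phi s e)) => //= eq_c.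
case: (eqVneq (phi (s f)) (phi (s e))) => //= ne.
(* The chosen point is the remainder of the new color modulo [m.+1] and the hash value is the
   quotient. *)
have eq_i : best f = best e.
  apply: val_inj; have := congr1 (modn^~ m.+1) eq_c.
  rewrite /recolor /= !modnMDl !modn_small //.
move: eq_c; rewrite /recolor -/(best e) -/(best f) eq_i => /addIn /eqP.
by rewrite eqn_mul2r /= => ->.
Qed.

(* An undecided node stands for a uniformly random color. *)
Definition undecided_wt (b : nat) (s t : S) (y z : option 'I_b.+1) : R :=
  wt s t * (if y is Some i then if z is Some i' then (i == i')%:R else b.+1%:R^-1
            else b.+1%:R^-1).

Definition decide (b : nat) (y : option 'I_b.+1) (i : 'I_b.+1) : option 'I_b.+1 :=
  if y is Some _ then y else Some i.

Definition split_pass (b q : nat) (psi : S -> nat) (s : E -> S) : E -> option 'I_b.+1 :=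
  pass adj psi (fun _ _ => 0) (@undecided_wt b) (@decide b) s (fun=> None) q.

Definition ord_color (b : nat) (y : option 'I_b.+1) : nat := if y is Some i then i else 0.

Lemma ord_color_lt (b : nat) (y : option 'I_b.+1) : (ord_color y < b.+1)%N.
Proof. by case: y => [i|] //=; rewrite ltn_ord. Qed.

(** With all nodes undecided a pair costs [1 / b.+1] of its weight, and the pass does not increase
    the total. Pairs with equal [psi], which the pass ignores, are charged in full. *)
Lemma split_mono (b q : nat) (psi : S -> nat) (s : E -> S) :
  symmetric adj -> (forall s t, wt s t = wt t s) -> (forall e, (psi (s e) < q)%N) ->
  mono (@ord_color b \o split_pass b q psi s) (fun e f => wt (s e) (s f)) <=
  mono (psi \o s) (fun e f => wt (s e) (s f)) +
  b.+1%:R^-1 * total_wt (fun e f => wt (s e) (s f)).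
Proof.
move=> adjC wtC psi_lt.
have decided e : exists i, split_pass b q psi s e = Some i.
  exact: (pass_cand adj (fun _ _ => 0) (@undecided_wt b) (@decide b) (fun=> None) (psi_lt e)).
have b_gt0 : 0 < b.+1%:R :> R by rewrite ltr0Sn.
have P_sym s1 s2 y z : @undecided_wt b s1 s2 y z = @undecided_wt b s2 s1 z y.
  rewrite /undecided_wt wtC; congr (_ * _).
  by case: y => [i|]; case: z => [i'|] //; rewrite eq_sym.
have U_mean (s1 : S) y : \sum_(i < b.+1) (fun=> fun=> 0 : R) s1 (@decide b y i) =
    b.+1%:R * (fun=> fun=> 0 : R) s1 y.
  by rewrite big1_eq mulr0.
have P_mean s1 s2 y z : \sum_i @undecided_wt b s1 s2 (@decide b y i) z =
    b.+1%:R * @undecided_wt b s1 s2 y z.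
  rewrite /undecided_wt; case: y => [i|] /=.
    by rewrite sumr_const card_ord mulr_natl.
  rewrite -mulr_sumr [RHS]mulrCA; congr (_ * _); rewrite divff ?gt_eqF //.
  case: z => [i'|]; last by rewrite sumr_const card_ord -(mulr_natl b.+1%:R^-1) divff ?gt_eqF.
  by rewrite (bigD1 i') //= eqxx big1 ?addr0 // => i /negPf ->.
have := pass_le psi adjC P_sym U_mean P_mean s (fun=> None) q.
rewrite -/(split_pass b q psi s) /pass_cost /= !big1_eq !add0r ler_pM2l ?invr_gt0 ?ltr0n //.
move=> le_cost.
apply: (@le_trans _ _ (mono (psi \o s) (fun e f => wt (s e) (s f)) +
   \sum_e \sum_(f | adj e f) (psi (s f) != psi (s e))%:R *
     undecided_wt (s e) (s f) (split_pass b q psi s e) (split_pass b q psi s f))).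
  rewrite -big_split; apply: ler_sum => e _; rewrite -big_split; apply: ler_sum => f _ /=.
  have [i ei] := decided e; have [i' fi] := decided f; rewrite ei fi /undecided_wt.
  have -> : (i == i') = (ord_color (Some i') == ord_color (Some i)) by rewrite eq_sym.
  rewrite (mulrC (wt _ _)) mulrA -mulrDl ler_wpM2r // -natrM -natrD ler_nat.
  by case: (psi (s f) == psi (s e)); case: (_ == _).
rewrite lerD2l; apply: le_trans le_cost _; rewrite mulr_sumr; apply: ler_sum => e _.
rewrite mulr_sumr; apply: ler_sum => f _; rewrite /undecided_wt [wt _ _ * _]mulrC.
by rewrite ler_piMl ?mulr_ge0 ?invr_ge0 ?ler0n // lern1 leq_b1.
Qed.

End Defective.

(** * Defective colorings in two levels *)

Section Rounding.
Local Open Scope ring_scope.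

Variables (R : realFieldType) (m1 m2 b : nat).
Variables (h1 : 'I_m1.+1 -> nat -> nat) (h2 : 'I_m2.+1 -> nat -> nat).
Variables (E : finType) (adj : rel E).

Section Refine.
Variables (S : Type) (wt : S -> S -> R) (phi : S -> nat) (s : E -> S).

(** The original data is carried along with each new color, so that later stages can still evaluate
    the weights. *)
Definition recolored1 (e : E) : S * nat := (s e, recolor adj wt h1 phi s e).

Definition recolored2 (e : E) : S * nat * nat :=
  (recolored1 e, recolor adj (fun p q => wt p.1 q.1) h2 snd recolored1 e).

Definition refine (e : E) : nat :=
  ord_color (split_pass adj (fun p q => wt p.1.1 q.1.1) b (m2.+1 * m2.+1) snd recolored2 e).

Lemma refine_lt (e : E) : (refine e < b.+1)%N.
Proof. exact: ord_color_lt. Qed.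

(** The monochromatic weight starts at 0, as [phi] is proper, and each of the three stages adds one
    of the three terms. The bound on [m1.+1 * m1.+1] makes the colors of the first stage legal
    inputs of the second code. *)
Lemma refine_mono (k1 k2 : nat) :
  symmetric adj -> (forall p q, 0 <= wt p q) -> (forall p q, wt p q = wt q p) ->
  good_hash k1 h1 -> good_hash k2 h2 -> (m1.+1 * m1.+1 <= m2.+1 ^ k2)%N ->
  (forall e, (phi (s e) < m1.+1 ^ k1)%N) ->
  (forall e f, adj e f -> phi (s e) != phi (s f)) ->
  mono adj refine (fun e f => wt (s e) (s f)) <=
  (k1%:R / m1.+1%:R + k2%:R / m2.+1%:R + b.+1%:R^-1) *
    total_wt adj (fun e f => wt (s e) (s f)).
Proof.
move=> adjC wt_ge0 wtC [h1_lt h1_clash] [h2_lt h2_clash] le_m phi_lt phi_proper.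
have lt_c1 e : (recolor adj wt h1 phi s e < m1.+1 * m1.+1)%N by apply: recolor_lt.
have lt_c2 e : ((recolored2 e).2 < m2.+1 * m2.+1)%N by apply: recolor_lt.
have := @split_mono _ _ adj _ (fun p q : S * nat * nat => wt p.1.1 q.1.1)
  (fun _ _ => wt_ge0 _ _) b _ snd recolored2 adjC (fun _ _ => wtC _ _) lt_c2.
move=> /le_trans; apply.
rewrite mulrDl lerD2r /=.
have := @recolor_mono _ _ adj _ (fun p q : S * nat => wt p.1 q.1) (fun _ _ => wt_ge0 _ _)
  m2 k2 h2 snd recolored1.
move=> /(_ _)/le_trans; apply=> [e f ne|].
  by apply: h2_clash => //; apply: leq_trans le_m; apply: lt_c1.
rewrite mulrDl lerD2r /=.
have := @recolor_mono _ _ adj _ wt wt_ge0 m1 k1 h1 phi s.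
move=> /(_ _)/le_trans; apply=> [e f ne|]; first exact: h1_clash.
rewrite [X in X + _](_ : _ = 0) ?add0r // /mono big1 // => e _.
by rewrite big1 // => f ef; rewrite /= eq_sym (negPf (phi_proper _ _ ef)) mul0r.
Qed.

End Refine.

Section TwoLevels.
Variables (S : Type) (wt : S -> S -> R) (phi : S -> nat) (s : E -> S).

Definition refined (e : E) : S * nat := (s e, refine wt phi s e).

Definition refined_wt (p q : S * nat) : R := (q.2 == p.2)%:R * wt p.1 q.1.

Definition defective (e : E) : nat :=
  (refine wt phi s e * b.+1 + refine refined_wt (phi \o fst) refined e)%N.

Lemma defective_lt (e : E) : (defective e < b.+1 * b.+1)%N.
Proof.
rewrite /defective; have := refine_lt wt phi s e.
have := refine_lt refined_wt (phi \o fst) refined e; nia.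
Qed.

(** The second refinement starts again from the proper [phi], but weighs only the pairs that the
    first left monochromatic. It keeps a fraction [eta] of that weight, which is itself at most a
    fraction [eta] of the total. *)
Lemma defective_mono (k1 k2 : nat) (eta : R) :
  symmetric adj -> (forall p q, 0 <= wt p q) -> (forall p q, wt p q = wt q p) ->
  good_hash k1 h1 -> good_hash k2 h2 -> (m1.+1 * m1.+1 <= m2.+1 ^ k2)%N ->
  (forall e, (phi (s e) < m1.+1 ^ k1)%N) ->
  (forall e f, adj e f -> phi (s e) != phi (s f)) ->
  k1%:R / m1.+1%:R + k2%:R / m2.+1%:R + b.+1%:R^-1 = eta ->
  mono adj defective (fun e f => wt (s e) (s f)) <=
  eta ^+ 2 * total_wt adj (fun e f => wt (s e) (s f)).
Proof.
move=> adjC wt_ge0 wtC hh1 hh2 le_m phi_lt phi_proper etaE.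
have eta_ge0 : 0 <= eta by rewrite -etaE !addr_ge0 ?mulr_ge0 ?invr_ge0 ?ler0n.
have rwt_ge0 p q : 0 <= refined_wt p q by rewrite mulr_ge0 ?ler0n.
have rwtC p q : refined_wt p q = refined_wt q p by rewrite /refined_wt eq_sym wtC.
have le1 := @refine_mono _ wt phi s k1 k2 adjC wt_ge0 wtC hh1 hh2 le_m phi_lt phi_proper.
have := @refine_mono _ refined_wt (phi \o fst) refined k1 k2 adjC rwt_ge0 rwtC hh1 hh2
  le_m phi_lt phi_proper.
rewrite etaE in le1 *; move=> le2.
rewrite expr2 -mulrA; apply: le_trans (_ : eta * mono adj (refine wt phi s)
  (fun e f => wt (s e) (s f)) <= _); last by rewrite ler_wpM2l.
apply: le_trans le2; apply: ler_sum => e _; apply: ler_sum => f _.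
rewrite /refined_wt /= mulrA ler_wpM2r // -natrM ler_nat.
case: eqP => // eq_d.
have lt_e := refine_lt refined_wt (phi \o fst) refined e.
have lt_f := refine_lt refined_wt (phi \o fst) refined f.
have eq1 : refine wt phi s f = refine wt phi s e.
  by have := congr1 (divn^~ b.+1) eq_d; rewrite /defective !divnMDl // !divn_small ?addn0.
have := congr1 (modn^~ b.+1) eq_d; rewrite /defective !modnMDl !modn_small // => ->.
by rewrite eq1 !eqxx.
Qed.

End TwoLevels.

(** ** One rounding step *)

Section Step.
Variables (l : E -> nat * R).

(* In [p : nat * R * R] the components are the input color, the value and the current
   fractional weight of an edge. *)
Definition conflict (p q : nat * R * R) : R := (p.1.2 + q.1.2) * (p.2 * q.2).

Definition labelled (x : E -> R) (e : E) : nat * R * R := (l e, x e).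

(** The defective coloring needs a weight that is nonnegative on all states, hence the absolute
    value; for nonnegative values and fractions it is [conflict] itself. *)
Definition chi (x : E -> R) (e : E) : nat :=
  defective (fun p q => `|conflict p q|) (fun p => p.1.1) (labelled x) e.

Definition colored (x : E -> R) (e : E) : nat * R * R * nat := (labelled x e, chi x e).

(** The cost being reduced is minus the objective, restricted to bichromatic pairs of [chi]. It is
    linear in each variable, and 0 and [2 * y] have mean [y]. *)
Definition round (lam : R) (x : E -> R) : E -> R :=
  pass adj snd (fun p z => - (p.1.1.2 * z))
    (fun p q y z => lam * ((p.1.1.2 + q.1.1.2) * (y * z)))
    (fun y (i : 'I_2) => if i == ord0 then 0 else 2 * y)
    (colored x) x (b.+1 * b.+1).

Definition weight (x : E -> R) (e f : E) : R := conflict (labelled x e) (labelled x f).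

(* [lam / 2], as [total_wt] counts every unordered pair twice. *)
Definition objective (lam : R) (x : E -> R) : R :=
  \sum_e (l e).2 * x e -
  lam / 2 * total_wt adj (weight x).


Lemma round_val (lam : R) (x : E -> R) (e : E) : round lam x e = 0 \/ round lam x e = 2 * x e.
Proof.
have [i] := pass_cand adj (fun p z => - (p.1.1.2 * z))
    (fun p q y z => lam * ((p.1.1.2 + q.1.1.2) * (y * z)))
    (fun y (i : 'I_2) => if i == ord0 then 0 else 2 * y) (s := colored x) x
    (defective_lt (fun p q => `|conflict p q|) (fun p => p.1.1) (labelled x) e :
      (snd (colored x e) < _)%N).
by rewrite -/(round lam x e) => ->; case: ifP => _; [left | right].
Qed.

Definition bichromatic (c : E -> nat) (w : E -> E -> R) : R :=
  \sum_e \sum_(f | adj e f) (c f != c e)%:R * w e f.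

Lemma total_mono (c : E -> nat) (w : E -> E -> R) :
  total_wt adj w = mono adj c w + bichromatic c w.
Proof.
rewrite -big_split; apply: eq_bigr => e _; rewrite -big_split; apply: eq_bigr => f _ /=.
by rewrite -mulrDl; case: eqP; rewrite /= ?addr0 ?add0r mul1r.
Qed.

Lemma round_cost (lam : R) (x : E -> R) :
  symmetric adj ->
  - (\sum_e (l e).2 * round lam x e) + lam / 2 * bichromatic (chi x) (weight (round lam x)) <=
  - (\sum_e (l e).2 * x e) + lam / 2 * bichromatic (chi x) (weight x).
Proof.
move=> adjC.
pose U (p : nat * R * R * nat) z : R := - (p.1.1.2 * z).
pose P (p q : nat * R * R * nat) y z : R := lam * ((p.1.1.2 + q.1.1.2) * (y * z)).
pose cand (y : R) (i : 'I_2) := if i == ord0 then 0 else 2 * y.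
have P_sym p q z z' : P p q z z' = P q p z' z by rewrite /P; ring.
have U_mean p z : \sum_i U p (cand z i) = 2%:R * U p z.
  by rewrite !big_ord_recl big_ord0 /U /cand /=; ring.
have P_mean p q z z' : \sum_i P p q (cand z i) z' = 2%:R * P p q z z'.
  by rewrite !big_ord_recl big_ord0 /P /cand /=; ring.
have costE z : pass_cost adj snd U P (colored x) z =
    - (\sum_e (l e).2 * z e) + lam / 2 * bichromatic (chi x) (weight z).
  rewrite /pass_cost /U sumrN; congr (_ + _).
  rewrite -mulrA [RHS]mulrCA; congr (_ * _); rewrite mulr_sumr; apply: eq_bigr => e _.
  rewrite mulr_sumr; apply: eq_bigr => f _; rewrite /P /weight /conflict /=; ring.
have := pass_le snd adjC P_sym U_mean P_mean (colored x) x (b.+1 * b.+1).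
by rewrite !costE.
Qed.

(** The linear and bichromatic terms are handled by [round_cost]. Values at most double, so the
    monochromatic weight at most quadruples, and its penalty is covered by the drop [dl] of the
    coefficient applied to the whole weight. *)
Lemma objective_round (k1 k2 : nat) (eta lam dl : R) (x : E -> R) :
  symmetric adj -> good_hash k1 h1 -> good_hash k2 h2 -> (m1.+1 * m1.+1 <= m2.+1 ^ k2)%N ->
  (forall e, ((l e).1 < m1.+1 ^ k1)%N) ->
  (forall e f, adj e f -> (l e).1 != (l f).1) ->
  k1%:R / m1.+1%:R + k2%:R / m2.+1%:R + b.+1%:R^-1 = eta ->
  (forall e, 0 <= (l e).2) -> (forall e, 0 <= x e) ->
  0 <= lam <= 2 -> 8 * eta ^+ 2 <= dl ->
  objective (lam + dl) x <= objective lam (round lam x).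
Proof.
move=> adjC hh1 hh2 le_m l_lt l_proper etaE a_ge0 x_ge0 /andP[lam_ge0 lam_le2] dl_ge.
have y_val := round_val lam x; set y := round lam x in y_val *.
have y_ge0 e : 0 <= y e by case: (y_val e) => ->; rewrite ?mulr_ge0.
have y_le e : y e <= 2 * x e by case: (y_val e) => ->; rewrite ?mulr_ge0.
have w_ge0 z e f : (forall e, 0 <= z e) -> 0 <= weight z e f.
  by move=> z_ge0; rewrite mulr_ge0 ?addr_ge0 ?mulr_ge0 /= ?a_ge0 ?z_ge0.
have := @defective_mono _ (fun p q => `|conflict p q|) (fun p => p.1.1) (labelled x) k1 k2 eta
  adjC (fun _ _ => normr_ge0 _) _ hh1 hh2 le_m l_lt l_proper etaE.
have -> : total_wt adj (fun e f => `|conflict (labelled x e) (labelled x f)|) =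
    total_wt adj (weight x).
  by apply: eq_bigr => e _; apply: eq_bigr => f _; rewrite ger0_norm ?w_ge0.
have -> : mono adj (defective (fun p q => `|conflict p q|) (fun p => p.1.1) (labelled x))
    (fun e f => `|conflict (labelled x e) (labelled x f)|) = mono adj (chi x) (weight x).
  by apply: eq_bigr => e _; apply: eq_bigr => f _; rewrite ger0_norm ?w_ge0.
have confC p q : `|conflict p q| = `|conflict q p|.
  by rewrite /conflict addrC (mulrC p.2).
move=> /(_ confC) mono_x.
have mono_y : mono adj (chi x) (weight y) <= 4 * mono adj (chi x) (weight x).
  rewrite mulr_sumr; apply: ler_sum => e _; rewrite mulr_sumr; apply: ler_sum => f _.
  rewrite [leRHS]mulrCA ler_wpM2l ?ler0n // /weight /conflict /=.
  rewrite [leRHS]mulrCA ler_wpM2l ?addr_ge0 //.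
  apply: le_trans (ler_pM (y_ge0 e) (y_ge0 f) (y_le e) (y_le f)) _.
  by rewrite le_eqVlt; apply/orP; left; apply/eqP; ring.
have := round_cost lam x adjC; rewrite -/y.
rewrite /objective -!/(weight _) (total_mono (chi x) (weight x)) (total_mono (chi x) (weight y)).
rewrite (total_mono (chi x) (weight x)) in mono_x.
have mono_x0 : 0 <= mono adj (chi x) (weight x) by apply: mono_ge0 => e f; apply: w_ge0.
have sep_x0 : 0 <= bichromatic (chi x) (weight x).
  by apply: sumr_ge0 => e _; apply: sumr_ge0 => f _; rewrite mulr_ge0 ?ler0n ?w_ge0.
move: (mono adj (chi x) (weight x)) (mono adj (chi x) (weight y))
  (bichromatic (chi x) (weight x)) (bichromatic (chi x) (weight y))
  mono_x mono_y mono_x0 sep_x0 => Mx My Sx Sy mono_x mono_y mono_x0 sep_x0.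
move: (\sum_e _) (\sum_e _) => ux uy cost_le.
(* [Mx] is at most [eta ^+ 2] times the total, so this is [8 * eta ^+ 2 <= dl]; the left side bounds
   [lam / 2 * My] because [lam <= 2]. *)
have le_dl : 4 * Mx <= dl / 2 * (Mx + Sx).
  apply: le_trans (_ : 4 * (eta ^+ 2 * (Mx + Sx)) <= _); first by rewrite ler_wpM2l.
  rewrite mulrA ler_wpM2r ?addr_ge0 //; lra.
have le_My : lam / 2 * My <= 4 * Mx.
  apply: le_trans (_ : lam / 2 * (4 * Mx) <= _); first by rewrite ler_wpM2l ?divr_ge0.
  by rewrite ler_piMl ?mulr_ge0 //; lra.
have lamM : 0 <= lam / 2 * Mx by rewrite mulr_ge0 // divr_ge0.
lra.
Qed.

End Step.
End Rounding.

(** * Iterated rounding and the selected edges *)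

Section Iteration.
Local Open Scope ring_scope.

Variables (R : realFieldType) (m1 m2 b : nat).
Variables (h1 : 'I_m1.+1 -> nat -> nat) (h2 : 'I_m2.+1 -> nat -> nat).
Variables (E : finType) (adj : rel E) (l : E -> nat * R) (n : nat).

Fixpoint iterate (i : nat) : E -> R :=
  if i is i'.+1 then round b h1 h2 adj l (2 - i'.+1%:R / n%:R) (iterate i')
  else fun=> 2 ^- n.

Lemma iterate_val (i : nat) (e : E) : iterate i e = 0 \/ iterate i e = 2 ^+ i / 2 ^+ n.
Proof.
elim: i => [|i IH] /=; first by right; rewrite mul1r.
case: (round_val b h1 h2 adj l (2 - i.+1%:R / n%:R) (iterate i) e) => ->; first by left.
by case: IH => ->; [left; rewrite mulr0 | right; rewrite mulrA -exprS].
Qed.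

Lemma iterate_ge0 (i : nat) (e : E) : 0 <= iterate i e.
Proof. by case: (iterate_val i e) => ->; rewrite ?divr_ge0 ?exprn_ge0. Qed.

(** For nonnegative [x] the vanishing sum says that all conflicting edges have value 0; as a sum
    over neighbours it fits [local_step]. *)
Definition selected (x : E -> R) (e : E) : bool :=
  (x e != 0) && (\sum_(f | adj e f) x f == 0).

Hypothesis adjC : symmetric adj.
Hypothesis l_ge0 : forall e, 0 <= (l e).2.

Lemma total_weight (x : E -> R) :
  total_wt adj (weight l x) = 2 * \sum_e \sum_(f | adj e f) (l e).2 * (x e * x f).
Proof.
rewrite mulr_natl mulr2n [X in _ = _ + X]dsum_sym // -big_split.
apply: eq_bigr => e _; rewrite -big_split; apply: eq_bigr => f _ /=.
by rewrite /weight /conflict /= (mulrC (x f)) -mulrDl.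
Qed.

(** An edge with [x e = 1] contributes its value times 1 minus the number of conflicting edges of
    value 1, which is positive only if that number is 0. *)
Lemma objective_selected (x : E -> R) :
  (forall e, x e = 0 \/ x e = 1) ->
  objective adj l 1 x <= \sum_(e | selected x e) (l e).2.
Proof.
move=> x01; rewrite /objective total_weight mulrA mulfVK ?mul1r ?pnatr_eq0 //.
have x_ge0 e : 0 <= x e by case: (x01 e) => ->.
rewrite -sumrB [leRHS]big_mkcond; apply: ler_sum => e _.
rewrite -mulr_sumr -mulr_sumr -mulrBr /selected.
case: (x01 e) => ->; first by rewrite eqxx mul0r subr0 mulr0.
rewrite oner_eq0 mul1r /=; case: eqP => [->|nz]; first by rewrite subr0 mulr1.
rewrite mulr_ge0_le0 // subr_le0.
have /exists_inP[f ef /eqP xf] : [exists (f | adj e f), x f == 1].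
  apply: contra_notT nz => /exists_inPn noone.
  by apply: big1 => f ef; case: (x01 f) => // xf; case/eqP: (noone f ef).
by rewrite (bigD1 f) //= xf lerDl sumr_ge0.
Qed.

(** With [p = 2 ^- n] and [D] conflicts an edge contributes [a * p * (1 - 2 * D * p)], and
    [4 * D * p <= 1] makes the bracket at least 1/2. *)
Lemma objective_const (deg_bound : nat) :
  (forall e, (#|[set f | adj e f]| <= deg_bound)%N) -> (4 * deg_bound <= 2 ^ n)%N ->
  2 ^- n / 2 * \sum_e (l e).2 <= objective adj l 2 (fun=> 2 ^- n).
Proof.
move=> deg_le le_n; rewrite /objective total_weight divff ?pnatr_eq0 // mul1r.
rewrite !mulr_sumr -sumrB; apply: ler_sum => e _.
set p := 2 ^- n; have p_gt0 : 0 < p by rewrite invr_gt0 exprn_gt0.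
rewrite -mulr_sumr sumr_const -[p * p *+ _]mulr_natl.
have -> : #|adj e| = #|[set f | adj e f]| by rewrite cardsE.
have : 4 * #|[set f | adj e f]|%:R * p <= 1.
  rewrite /p -ler_pdivlMr ?invr_gt0 ?exprn_gt0 // mul1r invrK -natrX -natrM ler_nat.
  by rewrite (leq_trans _ le_n) // leq_mul2l deg_le.
move: (#|_|%:R) (l_ge0 e) => D; move: ((l e).2) => a a_ge0 D_le.
have : 0 <= a * p * (1 - 4 * D * p) by rewrite !mulr_ge0 ?subr_ge0 // ltW.
lra.
Qed.

Lemma iterate_objective (k1 k2 : nat) (eta : R) (i : nat) :
  good_hash k1 h1 -> good_hash k2 h2 -> (m1.+1 * m1.+1 <= m2.+1 ^ k2)%N ->
  (forall e, ((l e).1 < m1.+1 ^ k1)%N) ->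
  (forall e f, adj e f -> (l e).1 != (l f).1) ->
  k1%:R / m1.+1%:R + k2%:R / m2.+1%:R + b.+1%:R^-1 = eta ->
  8 * eta ^+ 2 <= n%:R^-1 -> (i <= n)%N ->
  objective adj l 2 (fun=> 2 ^- n) <= objective adj l (2 - i%:R / n%:R) (iterate i).
Proof.
move=> hh1 hh2 le_m l_lt l_proper etaE eta_le; elim: i => [|i IH] lt_i.
  by rewrite mul0r subr0.
apply: le_trans (IH (ltnW lt_i)) _ => /=.
have n_gt0 : 0 < n%:R :> R by rewrite ltr0n; apply: leq_ltn_trans lt_i.
have -> : 2 - i%:R / n%:R = 2 - i.+1%:R / n%:R + n%:R^-1 :> R.
  by rewrite -[i.+1%:R]natr1 mulrDl; ring.
apply: (objective_round (k1 := k1) (k2 := k2) (eta := eta)) => // [e|].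
  exact: iterate_ge0.
have le1 : i.+1%:R / n%:R <= 1 :> R by rewrite ler_pdivrMr // mul1r ler_nat.
have ge0 : 0 <= i.+1%:R / n%:R :> R by rewrite divr_ge0.
by apply/andP; split; lra.
Qed.

Lemma selected_value (k1 k2 deg_bound : nat) (eta : R) :
  good_hash k1 h1 -> good_hash k2 h2 -> (m1.+1 * m1.+1 <= m2.+1 ^ k2)%N ->
  (forall e, ((l e).1 < m1.+1 ^ k1)%N) ->
  (forall e f, adj e f -> (l e).1 != (l f).1) ->
  k1%:R / m1.+1%:R + k2%:R / m2.+1%:R + b.+1%:R^-1 = eta ->
  8 * eta ^+ 2 <= n%:R^-1 -> (0 < n)%N ->
  (forall e, (#|[set f | adj e f]| <= deg_bound)%N) -> (4 * deg_bound <= 2 ^ n)%N ->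
  2 ^- n / 2 * \sum_e (l e).2 <= \sum_(e | selected (iterate n) e) (l e).2.
Proof.
move=> hh1 hh2 le_m l_lt l_proper etaE eta_le n_gt0 deg_le le_n.
apply: le_trans (objective_const deg_le le_n) _.
apply: le_trans (iterate_objective hh1 hh2 le_m l_lt l_proper etaE eta_le (leqnn n)) _.
rewrite divff ?pnatr_eq0 ?gtn_eqF // (_ : 2 - 1 = 1); last by ring.
apply: objective_selected => e; case: (iterate_val n e) => ->; first by left.
by right; rewrite divff // expf_neq0 // pnatr_eq0.
Qed.

Lemma selected_indep (x : E -> R) (e f : E) :
  (forall e, 0 <= x e) -> adj e f -> selected x e -> ~~ selected x f.
Proof.
move=> x_ge0 ef /andP[_ /eqP s0]; rewrite negb_and negbK; apply/orP; left.
by have /eqP := psumr_eq0P (fun f _ => x_ge0 f) s0 ef.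
Qed.

End Iteration.

(** * Locality *)

(** Inputs are bundled so that locality can quantify over all of them. Nonempty [ends] let an edge
    find itself two steps away; injective identifiers tell repeated walks from different edges. *)
Record instance := Instance {
  vertex : finType;
  edge : finType;
  ends : edge -> {set vertex};
  value : edge -> R;
  ident : (vertex + edge)%type -> nat;
  color : (vertex + edge)%type -> nat;
  ends_neq0 : forall e, ends e != set0;
  ident_inj : injective ident }.

Definition meets (I : instance) : rel (edge I) :=
  fun e f => (e != f) && ~~ [disjoint ends e & ends f].
Arguments meets : clear implicits.

Lemma meets_sym (I : instance) : symmetric (meets I).
Proof. by move=> e f; rewrite /meets eq_sym disjoint_sym. Qed.

Definition see (I : instance) (t : nat) (e : edge I) : view label :=
  view_at (@ends I) (@value I) (@ident I) (@color I) t (inr e).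

(** One function [g] has to serve all instances: this is what makes [s] computable in [t] rounds. *)
Definition local (t : nat) (S : Type) (s : forall I, edge I -> S) : Prop :=
  exists g : view label -> S, forall I (e : edge I), s I e = g (see t e).

Definition view_root (w : view label) : label := let: VNode x _ := w in x.

Definition view_children (w : view label) : seq (view label) := let: VNode _ ws := w in ws.

Fixpoint view_trunc (t : nat) (w : view label) : view label :=
  let: VNode x ws := w in VNode x (if t is t'.+1 then map (view_trunc t') ws else [::]).

Lemma view_trunc_at (V E : finType) (inc : E -> {set V}) (a : E -> R)
    (id col : (V + E)%type -> nat) (t t' : nat) (x : (V + E)%type) :
  t <= t' -> view_trunc t (view_at inc a id col t' x) = view_at inc a id col t x.
Proof.
elim: t t' x => [|t IH] [|t'] x //= le_t; congr VNode.
by rewrite -map_comp; apply: eq_map => y /=; apply: IH.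
Qed.

Lemma local_mono (t t' : nat) (S : Type) (s : forall I, edge I -> S) :
  t <= t' -> local t s -> local t' s.
Proof.
move=> le_t [g sE]; exists (g \o view_trunc t) => I e.
by rewrite sE /= /see view_trunc_at.
Qed.

Lemma local_map (t : nat) (S S' : Type) (F : S -> S') (s : forall I, edge I -> S) :
  local t s -> local t (fun I e => F (s I e)).
Proof. by move=> [g sE]; exists (F \o g) => I e; rewrite sE. Qed.

Lemma local_pair (t : nat) (S S' : Type) (s : forall I, edge I -> S)
    (s' : forall I, edge I -> S') :
  local t s -> local t s' -> local t (fun I e => (s I e, s' I e)).
Proof. by move=> [g sE] [g' s'E]; exists (fun w => (g w, g' w)) => I e; rewrite sE s'E. Qed.

(** Endpoints of the walks edge, vertex, edge from [e], with repetitions and with [e] itself, in the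
    order in which the view lists them. *)
Definition reach (I : instance) (e : edge I) : seq (edge I) :=
  [seq f | y <- nbrs (@ends I) (@ident I) (inr e),
           f <- pmap (fun z => if z is inr f then Some f else None)
                     (nbrs (@ends I) (@ident I) y)].

Lemma mem_nbrs (V E : finType) (inc : E -> {set V}) (id : (V + E)%type -> nat) x y :
  (y \in nbrs inc id x) = inc_adj inc x y.
Proof. by rewrite mem_sort mem_filter mem_enum inE andbT. Qed.

Lemma mem_reach (I : instance) (e f : edge I) :
  (f \in reach e) = ~~ [disjoint ends e & ends f].
Proof.
apply/allpairsPdep/pred0Pn => [[y [f' []]]|[v /andP[ve vf]]].
  rewrite mem_nbrs mem_pmap => ye /mapP[[v|f''] //].
  rewrite mem_nbrs => yf [->] ->; case: y ye yf => // v ve vf.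
  by exists v; apply/andP.
exists (inl v), f; split=> //; first by rewrite mem_nbrs.
by rewrite mem_pmap; apply/mapP; exists (inr f) => //; rewrite mem_nbrs.
Qed.

Definition grandchildren (w : view label) : seq (view label) :=
  flatten (map view_children (view_children w)).

Lemma grandchildren_see (I : instance) (t : nat) (e : edge I) :
  grandchildren (see t.+2 e) = [seq see t f | f <- reach e].
Proof.
rewrite /grandchildren /see /= -map_comp /reach map_allpairs; congr flatten.
apply/eq_in_map => y; rewrite mem_nbrs /=; case: y => // v _ /=.
(* A vertex node has only edge nodes as neighbours, so the [pmap] in [reach] drops nothing. *)
have : all (fun z => if z is inr _ then true else false) (nbrs (@ends I) (@ident I) (inl v)).
  by apply/allP => z; rewrite mem_nbrs; case: z.
by elim: (nbrs _ _ _) => //= -[] //= f s IH /IH ->.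
Qed.

(* Distinct walks reach the same edge, so the copies of its view are told apart by identifier. *)
Definition locate (w : view label) (i : nat) : view label :=
  nth w (grandchildren w) (index i [seq (view_root u).1.1 | u <- grandchildren w]).

Lemma locate_see (I : instance) (t : nat) (e f : edge I) :
  f \in reach e -> locate (see t.+2 e) (ident (inr f)) = see t f.
Proof.
move=> fe; rewrite /locate grandchildren_see -map_comp.
have id_inj : injective (fun f : edge I => ident (inr f)) by move=> ? ? /ident_inj [].
have -> : [seq ((fun u => (view_root u).1.1) \o see t) f | f <- reach e] =
    [seq ident (inr f) | f : edge I <- reach e].
  by apply: eq_map => f' /=; case: t.
by rewrite (index_map id_inj) (nth_map f) ?index_mem // nth_index.
Qed.

Section Simulation.
Local Open Scope ring_scope.
Variable K : realFieldType.

(** Recoloring, one class of a pass and the final selection all have this form: a rule [G] that sees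
    its own state and may sum any function over the conflicting edges. Conflicting edges are at
    distance two, hence two more rounds. *)
Lemma local_step (S S' : Type) (G : S -> ((S -> K) -> K) -> S') (t : nat)
    (s : forall I, edge I -> S) :
  local t s ->
  local t.+2 (fun I e => G (s I e) (fun h => \sum_(f | meets I e f) h (s I f))).
Proof.
case=> g sE.
(* Summing over distinct identifiers counts an edge once even if it shares several vertices, and the
   edge's own identifier is skipped. *)
exists (fun w => G (g (locate w (view_root w).1.1)) (fun h =>
  \sum_(i <- undup [seq (view_root u).1.1 | u <- grandchildren w] | i != (view_root w).1.1)
    h (g (locate w i)))) => I e.
have root_id t' (f : edge I) : (view_root (see t' f)).1.1 = ident (inr f) by case: t'.
have id_inj : injective (fun f : edge I => ident (inr f)) by move=> ? ? /ident_inj [].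
rewrite root_id locate_see -?sE; last first.
  by rewrite mem_reach -setI_eq0 setIid ends_neq0.
congr (G _ _); apply: functional_extensionality => h.
rewrite grandchildren_see -map_comp (eq_map (root_id t)) (undup_map_inj id_inj) big_map.
rewrite -big_filter big_uniq ?filter_uniq ?undup_uniq //.
apply: eq_big => [f|f ef].
  by rewrite mem_filter mem_undup mem_reach /meets (inj_eq id_inj) eq_sym.
by rewrite sE locate_see // mem_reach; case/andP: ef.
Qed.

Lemma recolor_local (S : Type) (wt : S -> S -> K) (m : nat) (h : 'I_m.+1 -> nat -> nat)
    (phi : S -> nat) (t : nat) (s : forall I, edge I -> S) :
  local t s -> local t.+2 (fun I e => recolor (meets I) wt h phi (s I) e).
Proof.
exact: (@local_step _ _ (fun p sum =>
  let i := [arg min_(i < ord0) sum (fun q =>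
    ((phi q != phi p) && (h i (phi q) == h i (phi p)))%:R * wt p q)]%O in
  (h i (phi p) * m.+1 + i)%N)).
Qed.

Lemma pass_local (S Y : Type) (m : nat) (psi : S -> nat) (U : S -> Y -> K)
    (P : S -> S -> Y -> Y -> K) (cand : Y -> 'I_m.+1 -> Y) (t q : nat)
    (s : forall I, edge I -> S) (y : forall I, edge I -> Y) :
  local t s -> local t y ->
  local (t + 2 * q) (fun I e => pass (meets I) psi U P cand (s I) (y I) q e).
Proof.
move=> loc_s loc_y; elim: q => [|q IH]; first by rewrite addn0.
rewrite mulnS addnCA.
have loc_s' : local (t + 2 * q) s by apply: local_mono loc_s; apply: leq_addr.
exact: (@local_step _ _ (fun p sum => if psi p.1 == q
  then cand p.2 [arg min_(i < ord0) (U p.1 (cand p.2 i) + sum (fun p' =>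
    (psi p'.1 != psi p.1)%:R * P p.1 p'.1 (cand p.2 i) p'.2))]%O
  else p.2) _ _ (local_pair loc_s' IH)).
Qed.

Variables (m1 m2 b : nat).
Variables (h1 : 'I_m1.+1 -> nat -> nat) (h2 : 'I_m2.+1 -> nat -> nat).

(** Two rounds for each of the two recolorings, and two for each class of the splitting pass. *)
Definition refine_rounds : nat := (4 + 2 * (m2.+1 * m2.+1))%N.

Lemma refine_local (S : Type) (wt : S -> S -> K) (phi : S -> nat) (t : nat)
    (s : forall I, edge I -> S) :
  local t s ->
  local (t + refine_rounds) (fun I e => refine b h1 h2 (meets I) wt phi (s I) e).
Proof.
move=> loc_s.
have loc1 : local t.+2 (fun I e => recolored1 h1 (meets I) wt phi (s I) e).
  by apply: local_pair; [apply: local_mono loc_s; lia | apply: recolor_local].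
have loc2 : local t.+4 (fun I e => recolored2 h1 h2 (meets I) wt phi (s I) e).
  apply: local_pair; first by apply: local_mono loc1; lia.
  exact: (recolor_local (fun p q => wt p.1 q.1) h2 snd loc1).
rewrite /refine_rounds addnA addn4; apply: local_map.
apply: pass_local => //; by exists (fun=> None).
Qed.

Lemma defective_local (S : Type) (wt : S -> S -> K) (phi : S -> nat) (t : nat)
    (s : forall I, edge I -> S) :
  local t s ->
  local (t + 2 * refine_rounds)
    (fun I e => defective b h1 h2 (meets I) wt phi (s I) e).
Proof.
move=> loc_s; rewrite mul2n -addnn addnA.
have loc1 := refine_local wt phi loc_s.
have loc_s1 : local (t + refine_rounds) s by apply: local_mono loc_s; apply: leq_addr.
have loc2 := refine_local (refined_wt wt) (phi \o fst) (local_pair loc_s1 loc1).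
have loc1' : local (t + refine_rounds + refine_rounds)
    (fun I e => refine b h1 h2 (meets I) wt phi (s I) e).
  by apply: local_mono loc1; apply: leq_addr.
exact: (local_map (fun p => p.1 * b.+1 + p.2)%N (local_pair loc1' loc2)).
Qed.

Definition round_rounds : nat := (2 * refine_rounds + 2 * (b.+1 * b.+1))%N.

Lemma round_local (lam : K) (t : nat) (l : forall I, edge I -> nat * K)
    (x : forall I, edge I -> K) :
  local t l -> local t x ->
  local (t + round_rounds)
    (fun I e => round b h1 h2 (meets I) (l I) lam (x I) e).
Proof.
move=> loc_l loc_x; rewrite /round_rounds addnA.
have loc_lx := local_pair loc_l loc_x.
have loc_chi := defective_local (fun p q => `|conflict p q|) (fun p => p.1.1) loc_lx.
have le_t : (t <= t + 2 * refine_rounds)%N by apply: leq_addr.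
apply: pass_local; last exact: local_mono loc_x.
by apply: local_pair; [apply: local_mono loc_lx | exact: loc_chi].
Qed.

End Simulation.

(** * Number of rounds *)

Lemma up_log2_le (n : nat) : up_log 2 n <= n.
Proof. by rewrite up_log_min // ltnW // ltn_expl. Qed.

Lemma expn_up_log_le (n : nat) : 0 < n -> 2 ^ up_log 2 n <= 2 * n.
Proof.
case: n => [//|[|n]] _; first by rewrite up_log1.
have /andP[lt_n _] := @up_log_bounds 2 n.+2 isT isT.
have gt0 : 0 < up_log 2 n.+2 by rewrite up_log_gt0.
by rewrite -(prednK gt0) expnS leq_mul2l ltnW.
Qed.

Lemma sqr_le_expn (n : nat) : n ^ 2 <= 2 * 2 ^ n.
Proof.
elim: n => [//|n IH]; have [n_le|n_ge] := leqP n 2; first by move: n n_le {IH} => [|[|[|]]].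
apply: (@leq_trans (2 * n ^ 2)); first by rewrite -!mulnn; nia.
by rewrite (expnS 2 n); lia.
Qed.

Lemma sqr_up_log_le (n : nat) : 0 < n -> up_log 2 n ^ 2 <= 4 * n.
Proof.
move=> n_gt0; apply: leq_trans (sqr_le_expn _) _.
by have := expn_up_log_le n_gt0; lia.
Qed.

Lemma up_logM_le (m n : nat) : up_log 2 (m * n) <= up_log 2 m + up_log 2 n.
Proof. by rewrite up_log_min // expnD leq_mul ?up_logP. Qed.

Lemma up_logX_le (m n : nat) : up_log 2 (m ^ n) <= n * up_log 2 m.
Proof.
elim: n => [|n IH]; first by rewrite expn0 up_log1.
by rewrite expnS mulSn (leq_trans (up_logM_le _ _)) // leq_add2l.
Qed.

Definition doublings (Delta r : nat) : nat := up_log 2 (4 * (r * Delta)).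

(** Up to constants the number of doublings is [log r + log Delta], and [log r] squared is O(r),
    which the term [r log Delta] absorbs since [log Delta >= 1]. *)
Lemma doublings_log_param (Delta r : nat) :
  1 < r -> 1 < Delta -> doublings Delta r ^ 2 <= 12 * (log_param Delta r).+1.
Proof.
move=> r_gt1 D_gt1; rewrite /log_param.
have L_gt0 : 0 < up_log 2 Delta by rewrite up_log_gt0.
have : doublings Delta r <= 2 + up_log 2 r + up_log 2 Delta.
  rewrite /doublings mulnA (leq_trans (up_logM_le _ _)) // leq_add2r.
  by rewrite (leq_trans (up_logM_le _ _)).
have := @sqr_up_log_le r (ltnW r_gt1); have := leq_mul (leqnn (4 * r)) L_gt0.
move: (doublings _ _) (up_log 2 r) (up_log 2 Delta) => n x y le_r le_x le_n.
apply: (@leq_trans ((2 + x + y) ^ 2)); first by rewrite leq_exp2r.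
have : (2 + x + y) ^ 2 <= 3 * (4 + x ^ 2 + y ^ 2).
  have [h1 _] := nat_Cauchy x y; have [h2 _] := nat_Cauchy 2 y.
  by have [h3 _] := nat_Cauchy 2 x; move: h1 h2 h3; rewrite -!mulnn; nia.
by move: le_r le_x; rewrite -!mulnn; nia.
Qed.

Lemma up_log_doublings (Delta r : nat) :
  1 < r -> 1 < Delta ->
  up_log 2 (doublings Delta r) <= 5 * up_log 2 (log_param Delta r).+2.
Proof.
move=> r_gt1 D_gt1; have := doublings_log_param r_gt1 D_gt1.
set X := log_param _ _; set n := doublings _ _ => le_n.
have : up_log 2 n <= up_log 2 (16 * X.+2) by apply: leq_up_log; nia.
have := up_logM_le 16 X.+2; have -> : up_log 2 16 = 4 by [].
have : 0 < up_log 2 X.+2 by rewrite up_log_gt0.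
lia.
Qed.

Lemma doublings_ge (Delta r : nat) : 1 < r -> 1 < Delta -> 4 <= doublings Delta r.
Proof.
move=> r_gt1 D_gt1; apply: (@leq_trans (up_log 2 16)) => //.
by apply: leq_up_log; nia.
Qed.

Lemma color_count_log (d Delta r : nat) :
  1 < r -> 1 < Delta ->
  up_log 2 (d * (r * Delta.+1) ^ d) <= d + d * doublings Delta r.
Proof.
move=> r_gt1 D_gt1; rewrite (leq_trans (up_logM_le _ _)) // leq_add ?up_log2_le //.
by rewrite (leq_trans (up_logX_le _ _)) // leq_mul2l leq_up_log ?orbT //; nia.
Qed.

(** A power of two of order [sqrt n], so that its logarithm is known exactly. *)
Definition branching (n : nat) : nat := 2 ^ ((up_log 2 n)./2 + 4).

Lemma branching_bounds (n : nat) :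
  0 < n -> 72 * n <= branching n ^ 2 /\ branching n ^ 2 <= 512 * n.
Proof.
move=> n_gt0; have le2n := expn_up_log_le n_gt0; have len := up_logP n (isT : 1 < 2).
have -> : branching n ^ 2 = 256 * 2 ^ (2 * (up_log 2 n)./2).
  rewrite -expnM (_ : _ * 2 = 8 + 2 * (up_log 2 n)./2); last by rewrite mulnDl; lia.
  by rewrite expnD.
have le1 : 2 ^ up_log 2 n <= 2 * 2 ^ (2 * (up_log 2 n)./2).
  by rewrite -expnS leq_exp2l //; lia.
have le2 : 2 ^ (2 * (up_log 2 n)./2) <= 2 ^ up_log 2 n by rewrite leq_exp2l //; lia.
lia.
Qed.

(** The input coloring has poly(r, Delta) colors, so [k1] is O(n); hence [k2] is O(log n), the
    second field has O(B log n) elements, and [n] steps of O(B^2 log^2 n) rounds take O(n^2 log^2 n)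
    in all. *)
Lemma parameters (d : nat) :
  exists C : nat, forall Delta r, 1 < r -> 1 < Delta ->
  exists m1 m2 b k1 k2 (h1 : 'I_m1.+1 -> nat -> nat) (h2 : 'I_m2.+1 -> nat -> nat),
    [/\ good_hash k1 h1 /\ good_hash k2 h2,
        m1.+1 * m1.+1 <= m2.+1 ^ k2 /\ d * (r * Delta.+1) ^ d <= m1.+1 ^ k1,
        b.+1 * k1 <= m1.+1 /\ b.+1 * k2 <= m2.+1,
        72 * doublings Delta r <= b.+1 ^ 2
      & doublings Delta r * round_rounds m2 b + 2 <= rounds_bound C 2 Delta r].
Proof.
(* 28 = 8 + 16 + 2 + 2 collects the terms of the round count, 512 bounds [B ^ 2 / n],
   [4 * (2 * d + 7) ^ 2] bounds [k2 ^ 2 / l ^ 2], and 12 and 25 come from [le_n2] and the square of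
   [le_l]. *)
exists (28 * 512 * 4 * (2 * d + 7) ^ 2 * 12 * 25) => Delta r r_gt1 D_gt1.
have n_ge4 := doublings_ge r_gt1 D_gt1.
have le_n2 := doublings_log_param r_gt1 D_gt1.
have le_l := up_log_doublings r_gt1 D_gt1.
have le_K := color_count_log d r_gt1 D_gt1.
set K := d * _ in le_K *; set n := doublings Delta r in n_ge4 le_n2 le_l le_K *.
set X := (log_param Delta r).+1 in le_n2 *; set l := up_log 2 n in le_l.
have [B_ge B_le] := branching_bounds (ltnW (ltnW (ltnW n_ge4))).
have B_gt0 : 0 < branching n by rewrite expn_gt0.
have B_gt1 : 1 < branching n by rewrite -[1]/(2 ^ 0) ltn_exp2l // addn4.
set B := branching n in B_ge B_le B_gt0 B_gt1 *.
(* Field sizes are powers of two at least [B] times the code dimension, for a defect of at most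
   [1 / B]. With [k2 = 2 * j1] already [2 ^ k2] is the number of colors after the first
   recoloring. *)
pose k1 := (up_log 2 K).+1; pose j1 := up_log 2 (B * k1); pose k2 := 2 * j1.
pose j2 := up_log 2 (B * k2).
have j1_gt0 : 0 < j1 by rewrite up_log_gt0 /= (leq_trans B_gt1) // leq_pmulr.
have k2_gt0 : 0 < k2 by rewrite muln_gt0.
have j2_gt0 : 0 < j2 by rewrite up_log_gt0 /= (leq_trans B_gt1) // leq_pmulr.
have predE j : (2 ^ j).-1.+1 = 2 ^ j by rewrite prednK ?expn_gt0.
have [h1 hh1] := hash_family k1 j1_gt0 (predE j1).
have [h2 hh2] := hash_family k2 j2_gt0 (predE j2).
have l_ge2 : 2 <= l by apply: (@leq_trans (up_log 2 4)) => //; apply: leq_up_log.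
have k2_le : k2 <= 2 * ((2 * d + 7) * l).
  rewrite leq_mul2l /=; apply: leq_trans (up_logM_le _ _) _.
  have -> : up_log 2 B = l./2 + 4 by rewrite /B /branching up_expnK.
  have le_k1 : k1 <= (2 * d + 1) * n by rewrite /k1; nia.
  have := leq_trans (leq_up_log 2 le_k1) (up_logM_le _ _); rewrite -/l.
  have := up_log2_le (2 * d + 1); nia.
have q2_le : 2 ^ j2 <= 2 * (B * k2) by rewrite expn_up_log_le // muln_gt0 B_gt0.
exists (2 ^ j1).-1, (2 ^ j2).-1, B.-1, k1, k2, h1, h2.
rewrite (prednK B_gt0) !predE; split=> //.
- split.
    by rewrite -expnD addnn -mul2n -/k2 leq_exp2r // (@leq_pexp2l 2 1).
  apply: leq_trans (up_logP K (isT : 1 < 2)) _.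
  by rewrite -expnM leq_pexp2l // (leq_trans (leqnSn _)) // leq_pmull.
- by split; apply: up_logP.
rewrite /round_rounds /refine_rounds (prednK B_gt0) !predE /rounds_bound -/X.
have {q2_le} := leq_mul q2_le q2_le; move: (2 ^ j2) => q q_le.
have {k2_le} := leq_mul k2_le k2_le; have := leq_mul k2_gt0 k2_gt0.
move: k2 q_le {k2_gt0 j2 j2_gt0 h2 hh2} => k2 q_le k_gt0 k_le.
have {le_l} := leq_mul le_l le_l; move: (up_log 2 _) => u l_le.
have BB_gt0 : 0 < B * B by rewrite muln_gt0 B_gt0.
rewrite -!mulnn in B_le le_n2 *.
apply: (@leq_trans (28 * (n * (B * B * (k2 * k2))))).
  by nia.
have step1 := leq_mul (leqnn n) (leq_mul B_le k_le).
have step2 := leq_mul (leq_mul le_n2 l_le) (leqnn ((2 * d + 7) * (2 * d + 7))).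
move: (B * B) (k2 * k2) (2 * d + 7) step1 step2 => b2 kk c; rewrite -/X -/l; lia.
Qed.

(** * The matching algorithm *)

Lemma wsumE (E : finType) (a : E -> R) (L : {set E}) :
  wsum a L = (\sum_(e in L) a e)%R.
Proof.
rewrite /wsum -big_enum /=; elim: (enum L) => [|e s IH]; first by rewrite big_nil.
by rewrite big_cons -IH.
Qed.

Lemma card_meets (I : instance) (Delta r : nat) (e : edge I) :
  (forall e, #|@ends I e| <= r) -> (forall v, deg (@ends I) v <= Delta) ->
  #|[set f | meets I e f]| <= r * Delta.
Proof.
move=> ends_le deg_le.
have sub : [set f | meets I e f] \subset \bigcup_(v in ends e) [set f | v \in ends f].
  apply/subsetP => f; rewrite inE => /andP[_ /pred0Pn[v /andP[ve vf]]].
  by apply/bigcupP; exists v; rewrite ?inE.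
apply: leq_trans (subset_leq_card sub) _.
apply: (@leq_trans (\sum_(v in ends e) deg (@ends I) v)).
  elim/big_rec2: _ => [|v n A _ le_A]; first by rewrite cards0.
  by rewrite (leq_trans (leq_card_setU _ _)) // leq_add2l.
apply: (@leq_trans (\sum_(v in ends e) Delta)); first exact: leq_sum.
by rewrite sum_nat_const leq_mul2r ends_le orbT.
Qed.

Section Assembly.
Local Open Scope ring_scope.

(** Each of the three terms is at most [1 / b.+1], and 72 is 8 times the square of 3. *)
Lemma defect_le (K : realFieldType) (m1 m2 b k1 k2 n : nat) :
  (b.+1 * k1 <= m1.+1)%N -> (b.+1 * k2 <= m2.+1)%N -> (72 * n <= b.+1 ^ 2)%N -> (0 < n)%N ->
  8 * (k1%:R / m1.+1%:R + k2%:R / m2.+1%:R + b.+1%:R^-1) ^+ 2 <= n%:R^-1 :> K.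
Proof.
move=> le1 le2 le_n n_gt0.
have ratio k m : (b.+1 * k <= m.+1)%N -> k%:R / m.+1%:R <= b.+1%:R^-1 :> K.
  by move=> le_m; rewrite ler_pdivrMr // mulrC ler_pdivlMr // -natrM ler_nat mulnC.
have sum_le : k1%:R / m1.+1%:R + k2%:R / m2.+1%:R + b.+1%:R^-1 <= 3 * b.+1%:R^-1 :> K.
  have -> : 3 * b.+1%:R^-1 = b.+1%:R^-1 + b.+1%:R^-1 + b.+1%:R^-1 :> K by ring.
  by rewrite !lerD ?ratio.
have sum_ge0 : 0 <= k1%:R / m1.+1%:R + k2%:R / m2.+1%:R + b.+1%:R^-1 :> K.
  by rewrite !addr_ge0 ?divr_ge0 ?invr_ge0.
apply: (@le_trans _ _ (8 * (3 * b.+1%:R^-1) ^+ 2)).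
  by rewrite ler_wpM2l // ler_sqr // nnegrE mulr_ge0 // invr_ge0.
rewrite exprMn exprVn mulrA ler_pdivrMr ?exprn_gt0 // [leRHS]mulrC ler_pdivlMr ?ltr0n //.
by move: le_n; rewrite -(ler_nat K) natrM natrX; lra.
Qed.

Definition edge_label (I : instance) (e : edge I) : nat * R := (color (inr e), value e).

Lemma edge_label_local : local 0 edge_label.
Proof.
by exists (fun w => ((view_root w).1.2, odflt R0 (view_root w).2)).
Qed.

Lemma iterate_local (m1 m2 b : nat) (h1 : 'I_m1.+1 -> nat -> nat)
    (h2 : 'I_m2.+1 -> nat -> nat) (n i : nat) :
  local (i * round_rounds m2 b)
    (fun I e => iterate b h1 h2 (meets I) (@edge_label I) n i e).
Proof.
elim: i => [|i IH]; first by exists (fun=> 2 ^- n).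
rewrite mulSnr; apply: round_local => //.
by apply: local_mono edge_label_local.
Qed.

Lemma selected_local (t : nat) (x : forall I, edge I -> R) :
  local t x -> local t.+2 (fun I e => selected (meets I) (x I) e).
Proof. exact: (@local_step _ _ _ (fun p sum => (p != 0) && (sum id == 0))). Qed.

(** Rounding [4 * D] up to a power of two costs a factor below 2, so [2 ^- n / 2] is at least
    [1 / (16 * D)]: the final constant. *)
Lemma rescale (K : realFieldType) (n : nat) (D A B : K) :
  2 ^+ n <= 8 * D -> 0 <= A -> 2 ^- n / 2 * A <= B -> 16^-1 * A <= B * D.
Proof.
move=> pow_le A_ge0 le_B.
have pow_gt0 : 0 < 2 ^+ n :> K by rewrite exprn_gt0.
have D_ge0 : 0 <= D by rewrite -(pmulr_rge0 _ (ltr0Sn K 7)) (le_trans _ pow_le) // ltW.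
apply: le_trans (ler_wpM2r D_ge0 le_B).
have inv_le : 1 <= 8 * (2 ^- n * D) by rewrite mulrCA -ler_pdivrMl ?invr_gt0 // mulr1 invrK.
have : 0 <= A * (8 * (2 ^- n * D) - 1) by rewrite mulr_ge0 // subr_ge0.
lra.
Qed.

End Assembly.

(** The value bound is multiplied out by [r * Delta], which avoids dividing by zero when
    [Delta = 0]. *)
Definition approximates (d Delta r T : nat) (out : view label -> bool) : Prop :=
  forall (V E : finType) (inc : E -> {set V}) (a : E -> R) (id col : (V + E)%type -> nat),
    2 <= r ->
    (forall e, inc e != set0) ->
    (forall e, #|inc e| <= r) ->
    (forall v, deg inc v <= Delta) ->
    (forall e, Rle R0 (a e)) ->
    injective id ->
    good_coloring inc col (d * (r * Delta.+1) ^ d) ->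
    let M := [set e | out (view_at inc a id col T (inr e))] in
    is_matching inc M /\
    Rle (Rmult (16^-1)%R (wsum a [set: E])) (Rmult (wsum a M) (Rmult (INR r) (INR Delta))).

Lemma trivial_approximates (d Delta r : nat) :
  Delta <= 1 -> approximates d Delta r 0 (fun=> true).
Proof.
move=> D_le1 V E inc a id col r_ge2 inc_neq0 _ deg_le a_ge0 _ _ M.
have {M} -> : M = [set: E] by apply/setP => e; rewrite !inE.
split=> [e f _ _ ne|].
  apply/pred0P => v; apply/negbTE/negP => /andP[ve vf].
  have : [set e; f] \subset [set e | v \in inc e].
    by apply/subsetP => g; rewrite !inE => /orP[] /eqP->.
  move=> /subset_leq_card; rewrite cards2 ne => /leq_trans /(_ (deg_le v)).
  by rewrite ltnNge D_le1.
rewrite wsumE; apply/RleP; rewrite !RmultE !INRE.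
have A_ge0 : (0 <= \sum_(e in [set: E]) a e)%R by apply: sumr_ge0 => e _; apply/RleP.
(* If [Delta = 0] there are no edges, since every edge has a vertex, and both sides vanish. *)
case: Delta D_le1 deg_le => [_ deg0|[] // _ _].
  rewrite mulr0 mulr0 big1 ?mulr0 // => e _; have /set0Pn[v ve] := inc_neq0 e.
  by have := deg0 v; rewrite leqn0 cards_eq0 => /eqP/setP/(_ e); rewrite !inE ve.
rewrite mulr1 mulrC ler_wpM2l // (@le_trans _ _ 1%R) ?invf_le1 ?ler1n //; lia.
Qed.

Lemma rounding_approximates (d Delta r m1 m2 b k1 k2 : nat)
    (h1 : 'I_m1.+1 -> nat -> nat) (h2 : 'I_m2.+1 -> nat -> nat) :
  1 < r -> 1 < Delta ->
  good_hash k1 h1 -> good_hash k2 h2 -> m1.+1 * m1.+1 <= m2.+1 ^ k2 ->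
  d * (r * Delta.+1) ^ d <= m1.+1 ^ k1 ->
  b.+1 * k1 <= m1.+1 -> b.+1 * k2 <= m2.+1 -> 72 * doublings Delta r <= b.+1 ^ 2 ->
  exists out, approximates d Delta r (doublings Delta r * round_rounds m2 b + 2) out.
Proof.
move=> r_gt1 D_gt1 hh1 hh2 le_m le_K le_k1 le_k2 le_n; set n := doublings Delta r in le_n *.
have n_gt0 : 0 < n by apply: leq_trans (doublings_ge r_gt1 D_gt1).
have [g gE] := selected_local (iterate_local b h1 h2 n n).
exists g => V E inc a id col _ inc_neq0 inc_le deg_le a_ge0 id_inj [col_lt col_proper] M.
pose I := Instance a col inc_neq0 id_inj.
pose x := iterate b h1 h2 (meets I) (@edge_label I) n n.
have ME : M = [set e : edge I | selected (meets I) x e].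
  by apply/setP => e; rewrite !inE /x (gE I e) addn2.
have l_ge0 (e : edge I) : (0 <= (edge_label e).2)%R by apply/RleP; apply: a_ge0.
have x_ge0 (e : edge I) : (0 <= x e)%R by apply: iterate_ge0.
split.
  rewrite ME => e f; rewrite !inE => sel_e sel_f ne; apply/negPn/negP => ef.
  have mef : meets I e f by apply/andP.
  by have := selected_indep x_ge0 mef sel_e; rewrite sel_f.
rewrite !wsumE ME; apply/RleP; rewrite !RmultE !INRE.
have proper (e f : edge I) : meets I e f -> (edge_label e).1 != (edge_label f).1.
  case/andP=> ne /pred0Pn[v /andP[ve vf]]; apply: col_proper => //.
  by apply/orP; right; apply/existsP; exists (inl v); apply/andP.
have l_lt (e : edge I) : (edge_label e).1 < m1.+1 ^ k1 by apply: leq_trans (col_lt _) le_K.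
have eta_le := defect_le R le_k1 le_k2 le_n n_gt0.
have le_pow : 4 * (r * Delta) <= 2 ^ n by apply: up_logP.
have pow_le : 2 ^ n <= 8 * (r * Delta).
  by apply: leq_trans (expn_up_log_le _) _; nia.
have := selected_value (@meets_sym I) l_ge0 hh1 hh2 le_m l_lt proper erefl eta_le n_gt0
  (fun e => @card_meets I Delta r e inc_le deg_le) le_pow.
rewrite -/x -natrM.
have -> : (\sum_(e in [set e | selected (meets I) x e]) a e =
    \sum_(e | selected (meets I) x e) (@edge_label I e).2)%R.
  by apply: eq_bigl => e; rewrite inE.
have -> : (\sum_(e in [set: E]) a e = \sum_e (@edge_label I e).2)%R.
  by apply: eq_bigl => e; rewrite inE.
have : (2 ^+ n <= 8 * (r * Delta)%N%:R :> R)%R by rewrite -natrX -natrM ler_nat.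
by move=> /rescale; apply; apply: sumr_ge0.
Qed.

Theorem theorem4p1 :
  exists c : R, Rlt R0 c /\
  forall d : nat, (* good colorings use at most d * (r*(Delta+1))^d = poly(r,Delta) colors *)
  exists (C k : nat)
         (T : nat -> nat -> nat -> nat)                  (* rounds, given n Delta r *)
         (out : nat -> nat -> nat -> view label -> bool), (* decision of an edge node *)
    (forall n Delta r, T n Delta r <= rounds_bound C k Delta r) /\
    forall (n Delta r : nat) (V E : finType) (inc : E -> {set V}) (a : E -> R)
           (id col : (V + E)%type -> nat),
      2 <= r ->
      #|V| <= n ->
      (forall e, inc e != set0) ->
      (forall e, #|inc e| <= r) ->
      (forall v, deg inc v <= Delta) ->
      (forall e, Rle R0 (a e)) ->
      injective id ->
      good_coloring inc col (d * (r * Delta.+1) ^ d) ->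
      let M := [set e | out n Delta r (view_at inc a id col (T n Delta r) (inr e))] in
      is_matching inc M /\
      Rle (Rmult c (wsum a [set: E])) (Rmult (wsum a M) (Rmult (INR r) (INR Delta))).
Proof.
exists (16^-1)%R; split; first by apply/RltP; rewrite invr_gt0 ltr0n.
move=> d; have [C params] := parameters d; exists C, 2.
(* The algorithm is chosen once for each pair [(Delta, r)], before any hypergraph is given. *)
have /functional_choice[f f_spec] (p : nat * nat) : exists q : nat * (view label -> bool),
    q.1 <= rounds_bound C 2 p.1 p.2 /\ approximates d p.1 p.2 q.1 q.2.
  case: p => Delta r /=; have [r_le1|r_gt1] := leqP r 1.
    exists (0, fun=> true); split=> // V E inc a id col r_ge2.
    by move: (leq_trans r_ge2 r_le1).
  have [D_le1|D_gt1] := leqP Delta 1.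
    by exists (0, fun=> true); split=> //; apply: trivial_approximates.
  have [m1 [m2 [b [k1 [k2 [h1 [h2]]]]]]] := params Delta r r_gt1 D_gt1.
  case=> -[hh1 hh2] [le_m le_K] [le_k1 le_k2] le_n le_rounds.
  have [out out_spec] := rounding_approximates r_gt1 D_gt1 hh1 hh2 le_m le_K le_k1 le_k2 le_n.
  by exists ((doublings Delta r * round_rounds m2 b + 2), out).
exists (fun _ Delta r => (f (Delta, r)).1), (fun _ Delta r => (f (Delta, r)).2); split.
  by move=> _ Delta r; case: (f_spec (Delta, r)).
move=> n Delta r V E inc a id col r_ge2 _; have [_] := f_spec (Delta, r).
exact.
Qed.
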